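(* Let $n\ge1$ be an integer, $\eta>1$, $L>0$, $M>0$, $y=r/L$, $\mu=M/L$, and let $F_n(x)=\int_0^x u^n(1-u)^n\,du\big/\mathrm B(n+1,n+1)$ on $[0,1]$. Set $$q_{n,\eta}=\max_{1\le y\le\eta}\frac{F_n[(y-1)/(\eta-1)]}{y}.$$ Consider the metric $$ds^2=-e^{2\Phi(r)}d\tau^2+\frac{dr^2}{1-2m(r)/r}+r^2d\Omega^2$$ with, writing $x=(r/L-1)/(\eta-1)$, $$m(r)=\begin{cases}0,&0\le r\le L,\\ M F_n(x),& L<r<\eta L,\\ M,& r\ge\eta L,\end{cases}\qquad \Phi'=\frac{m}{r(r-2m)},\qquad \Phi(\infty)=0 .$$ These define a nontrivial, asymptotically flat, horizon-free $C^n$ spacetime with a flat cavity ($r\le L$), an exact Schwarzschild exterior ($r\ge\eta L$), and no thin shell, whenever $$0<\mu\le\mu_{\rm DEC}(n,\eta)\equiv\frac{0.4}{q_{n,\eta}} .$$ Its Type-I source satisfies NEC, WEC, SEC, and DEC everywhere. DEC is saturated at the upper endpoint $\mu=\mu_{\rm DEC}(n,\eta)$; for $\mu<\mu_{\rm DEC}(n,\eta)$ the DEC margin is strict. For $n=4$, $\eta=3$, one has $q_{4,3}=0.380436713748\ldots$ and $\mu_{\rm DEC}=1.051423234257\ldots$.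
   Context: Geometric units $G=c=1$; $\mathrm B$ is the Euler beta function. The source is $T_{\mu\nu}=G_{\mu\nu}/(8\pi)$, diagonal in the static orthonormal frame, with energy density $\rho$, radial pressure $p_r$, and tangential pressure $p_\perp$ (both angular directions). With $f=1-2m/r$, $$\rho=\frac{m'}{4\pi r^2},\qquad 8\pi p_r=-\frac{2m}{r^3}+\frac2r f\,\Phi',\qquad 8\pi p_\perp=f\Big(\Phi''+\Phi'^2+\frac{\Phi'}r\Big)+\frac{f'}2\Big(\Phi'+\frac1r\Big).$$ Energy conditions for such a (Type-I) source: NEC: $\rho+p_r\ge0$ and $\rho+p_\perp\ge0$. WEC: $\rho\ge0$ and NEC. SEC: NEC and $\rho+p_r+2p_\perp\ge0$. DEC: $\rho\ge|p_r|$ and $\rho\ge|p_\perp|$. ''DEC saturated'' means that equality $p_\perp=\rho$ is attained at a point with $\rho>0$; ''strict DEC margin'' means the DEC inequalities are strict wherever $\rho>0$. ''Horizon-free'' means $1-2m(r)/r>0$ for all $r>0$. ''$C^n$ spacetime'' means the metric functions are $C^n$. ''Flat cavity'' means $m=0$ and $\Phi$ is constant for $r\le L$. ''Exact Schwarzschild exterior'' means $e^{2\Phi}=1-2M/r$ and $m=M$ for $r\ge\eta L$. ''No thin shell'' means that at $r=L$ and $r=\eta L$ the induced metric and the extrinsic curvature of the worldtube $r=\text{const}$ agree from both sides ($[h_{ab}]=[K_{ab}]=0$), so that the Israel surface tensor vanishes; with normal $n^\mu=\sqrt f\,\delta^\mu_r$, the nonzero components are $K_{\tau\tau}=-e^{2\Phi}\sqrt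 f\,\Phi'$, $K_{\theta\theta}=r\sqrt f$, $K_{\phi\phi}=\sin^2\theta\,K_{\theta\theta}$. *)

(* Defs.v *)
From Stdlib Require Import Reals.
From Coquelicot Require Import Coquelicot.
Open Scope R_scope.

(** Euler's beta function at positive integer arguments. *)
Definition euler_beta (a b : nat) : R :=
  RInt (fun t => t ^ (a - 1) * (1 - t) ^ (b - 1)) 0 1.

Definition F (n : nat) (x : R) : R :=
  RInt (fun u => u ^ n * (1 - u) ^ n) 0 x / euler_beta (n + 1) (n + 1).

Definition compactness (n : nat) (eta y : R) : R :=
  F n ((y - 1) / (eta - 1)) / y.

Definition is_max_on (f : R -> R) (a b v : R) : Prop :=
  (exists y, a <= y <= b /\ f y = v) /\ (forall y, a <= y <= b -> f y <= v).

(** The supremum of [compactness n eta] on [[1, eta]], attained because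
    [compactness n eta] is continuous. *)
Definition q (n : nat) (eta : R) : R :=
  real (Lub_Rbar (fun v => exists y, 1 <= y <= eta /\ v = compactness n eta y)).

Definition mu_DEC (n : nat) (eta : R) : R := 0.4 / q n eta.

Definition mass (n : nat) (eta L M r : R) : R :=
  if Rle_dec r L then 0
  else if Rlt_dec r (eta * L) then M * F n ((r / L - 1) / (eta - 1))
  else M.

(** [Phi] and [m] below are functions of the areal radius; only their values
    at nonnegative radii are meaningful. *)

Definition blackening (m : R -> R) (r : R) : R := 1 - 2 * m r / r.

(** The differential equation is imposed at every [r > 0]; the value at the
    centre is fixed by continuity. *)
Definition is_potential (m Phi : R -> R) : Prop :=
  (forall r, 0 < r -> is_derive Phi r (m r / (r * (r - 2 * m r)))) /\
  filterlim Phi (at_right 0) (locally (Phi 0)) /\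
  is_lim Phi p_infty 0.

Inductive coord := Tau | Rad | Theta | Varphi.

Definition coord_eq_dec (a b : coord) : {a = b} + {a <> b}.
Proof. decide equality. Defined.

Definition sum_coord (f : coord -> R) : R :=
  f Tau + f Rad + f Theta + f Varphi.

Definition event := coord -> R.

Definition tensor2 := event -> coord -> coord -> R.

(** The domain of the spherical chart. *)
Definition in_chart (x : event) : Prop :=
  0 < x Rad /\ 0 < x Theta < PI.

Definition g_tt (Phi : R -> R) (r : R) : R := - exp (2 * Phi r).
Definition g_rr (m : R -> R) (r : R) : R := / blackening m r.

Definition metric (Phi m : R -> R) : tensor2 := fun x a b =>
  match a, b with
  | Tau, Tau => g_tt Phi (x Rad)
  | Rad, Rad => g_rr m (x Rad)
  | Theta, Theta => x Rad ^ 2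
  | Varphi, Varphi => x Rad ^ 2 * sin (x Theta) ^ 2
  | _, _ => 0
  end.

(** Conventions: signature [(-,+,+,+)],
    [R^a_{bcd} = d_c Gamma^a_{db} - d_d Gamma^a_{cb} + ...],
    [R_{bd} = R^a_{bad}]. *)

Definition update (x : event) (a : coord) (s : R) : event :=
  fun b => if coord_eq_dec b a then s else x b.

Definition partial (a : coord) (f : event -> R) (x : event) : R :=
  Derive (fun s => f (update x a s)) (x a).

(** Inverse of a metric whose off-diagonal components vanish. *)
Definition inverse_diag (g : tensor2) : tensor2 := fun x a b =>
  if coord_eq_dec a b then / g x a a else 0.

(** [christoffel g a b c x] is [Gamma^a_{bc}]. *)
Definition christoffel (g : tensor2) (a b c : coord) (x : event) : R :=
  / 2 * sum_coord (fun s => inverse_diag g x a s *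
    (partial b (fun z => g z c s) x + partial c (fun z => g z b s) x
     - partial s (fun z => g z b c) x)).

(** [riemann g a b c d x] is [R^a_{bcd}]. *)
Definition riemann (g : tensor2) (a b c d : coord) (x : event) : R :=
  partial c (christoffel g a d b) x - partial d (christoffel g a c b) x
  + sum_coord (fun s => christoffel g a c s x * christoffel g s d b x
                        - christoffel g a d s x * christoffel g s c b x).

Definition ricci (g : tensor2) : tensor2 := fun x b d =>
  sum_coord (fun a => riemann g a b a d x).

Definition scalar_curvature (g : tensor2) (x : event) : R :=
  sum_coord (fun a => sum_coord (fun b => inverse_diag g x a b * ricci g x a b)).

Definition einstein (g : tensor2) : tensor2 := fun x a b =>
  ricci g x a b - / 2 * scalar_curvature g x * g x a b.

Definition stress_energy (g : tensor2) : tensor2 := fun x a b =>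
  einstein g x a b / (8 * PI).

(** Components in the orthonormal frame [|g_aa|^(-1/2) d_a]. *)
Definition frame_components (g t : tensor2) : tensor2 := fun x a b =>
  t x a b / (sqrt (Rabs (g x a a)) * sqrt (Rabs (g x b b))).

Definition rho (m : R -> R) (r : R) : R := Derive m r / (4 * PI * r ^ 2).

Definition p_r (Phi m : R -> R) (r : R) : R :=
  (- (2 * m r) / r ^ 3 + 2 / r * blackening m r * Derive Phi r) / (8 * PI).

Definition p_perp (Phi m : R -> R) (r : R) : R :=
  (blackening m r * (Derive_n Phi 2 r + Derive Phi r ^ 2 + Derive Phi r / r)
   + Derive (blackening m) r / 2 * (Derive Phi r + 1 / r)) / (8 * PI).

Definition type_I_source (Phi m : R -> R) : Prop :=
  forall x a b, in_chart x ->
    frame_components (metric Phi m) (stress_energy (metric Phi m)) x a b =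
    match a, b with
    | Tau, Tau => rho m (x Rad)
    | Rad, Rad => p_r Phi m (x Rad)
    | Theta, Theta | Varphi, Varphi => p_perp Phi m (x Rad)
    | _, _ => 0
    end.

Definition NEC (e pr pt : R) : Prop := 0 <= e + pr /\ 0 <= e + pt.
Definition WEC (e pr pt : R) : Prop := 0 <= e /\ NEC e pr pt.
Definition SEC (e pr pt : R) : Prop := NEC e pr pt /\ 0 <= e + pr + 2 * pt.
Definition DEC (e pr pt : R) : Prop := Rabs pr <= e /\ Rabs pt <= e.

Definition everywhere (EC : R -> R -> R -> Prop) (Phi m : R -> R) : Prop :=
  forall r, 0 < r -> EC (rho m r) (p_r Phi m r) (p_perp Phi m r).

Definition DEC_saturated (Phi m : R -> R) : Prop :=
  exists r, 0 < r /\ 0 < rho m r /\ p_perp Phi m r = rho m r.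

Definition strict_DEC_margin (Phi m : R -> R) : Prop :=
  forall r, 0 < r -> 0 < rho m r ->
    Rabs (p_r Phi m r) < rho m r /\ Rabs (p_perp Phi m r) < rho m r.

(** [rho] is a frame component of the Einstein tensor over [8 PI], so this
    excludes flat space. *)
Definition nontrivial (m : R -> R) : Prop := exists r, 0 < r /\ rho m r <> 0.

Definition horizon_free (m : R -> R) : Prop := forall r, 0 < r -> 0 < blackening m r.

Definition Cn_on_pos (n : nat) (f : R -> R) : Prop :=
  forall k r, (k <= n)%nat -> 0 < r ->
    ex_derive_n f k r /\ continuous (Derive_n f k) r.

(** The two remaining metric components are smooth in any case, and regularity
    at [r = 0] comes from [flat_cavity]. *)
Definition Cn_spacetime (n : nat) (Phi m : R -> R) : Prop :=
  Cn_on_pos n (g_tt Phi) /\ Cn_on_pos n (g_rr m).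

(** [h = O(1/r)] at infinity, with [h' = O(1/r^2)] and [h'' = O(1/r^3)]. *)
Definition falls_off (h : R -> R) : Prop :=
  forall k, (k <= 2)%nat -> exists C R0, 0 < R0 /\
    forall r, R0 < r ->
      ex_derive_n h k r /\ Rabs (Derive_n h k r) <= C / r ^ (k + 1).

(** In the associated Cartesian coordinates this is
    [d^k (g - diag(-1,1,1,1)) = O(r^(-1-k))] for [k <= 2]. *)
Definition asymptotically_flat (Phi m : R -> R) : Prop :=
  falls_off (fun r => g_tt Phi r + 1) /\ falls_off (fun r => g_rr m r - 1).

Definition flat_cavity (L : R) (Phi m : R -> R) : Prop :=
  exists c, forall r, 0 <= r <= L -> m r = 0 /\ Phi r = c.

Definition schwarzschild_exterior (R0 M : R) (Phi m : R -> R) : Prop :=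
  forall r, R0 <= r -> exp (2 * Phi r) = 1 - 2 * M / r /\ m r = M.

(** First and second fundamental forms of the worldtube [r = const], in the
    coordinates [Tau], [Theta], [Varphi], for the normal [sqrt f d_r]. *)
Inductive tube_coord := TTau | TTheta | TVarphi.

Definition tube_h (Phi : R -> R) (theta : R) (a b : tube_coord) (r : R) : R :=
  match a, b with
  | TTau, TTau => - exp (2 * Phi r)
  | TTheta, TTheta => r ^ 2
  | TVarphi, TVarphi => r ^ 2 * sin theta ^ 2
  | _, _ => 0
  end.

Definition tube_K (Phi m : R -> R) (theta : R) (a b : tube_coord) (r : R) : R :=
  match a, b with
  | TTau, TTau => - exp (2 * Phi r) * sqrt (blackening m r) * Derive Phi r
  | TTheta, TTheta => r * sqrt (blackening m r)
  | TVarphi, TVarphi => sin theta ^ 2 * (r * sqrt (blackening m r))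
  | _, _ => 0
  end.

Definition no_jump (f : R -> R) (r0 : R) : Prop :=
  exists l : R, filterlim f (at_left r0) (locally l) /\
                filterlim f (at_right r0) (locally l).

Definition no_thin_shell_at (Phi m : R -> R) (r0 : R) : Prop :=
  forall theta a b, 0 < theta < PI ->
    no_jump (tube_h Phi theta a b) r0 /\ no_jump (tube_K Phi m theta a b) r0.

(* Main.v *)
(** The equation for [Phi'] makes [p_r] vanish, and then the Einstein equations
    give [p_perp = rho * m / (2 (r - 2 m))].  Since [rho >= 0], the dominant
    energy condition reduces to [5 m <= 2 r], that is [m / r <= 2 / 5], and
    [m / r] has maximum [q * M / L].  At the upper endpoint the function
    [2 r - 5 m >= 0] has an interior zero, hence [m' = 2 / 5 > 0] there, so that
    [rho > 0] and the condition is saturated.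

    Only [F_n' = u^n (1 - u)^n / B] restricts the regularity: cut off outside
    [[0,1]] it is [C^(n-1)], so [m] is [C^n] and [Phi] is [C^(n+1)].  For [n = 1]
    the derivative of [Gamma^r_{rr}] need not exist, but it cancels from the
    Ricci tensor. *)

Require Import Defs.
From Stdlib Require Import Reals Lra Lia Psatz.
From Coquelicot Require Import Coquelicot.
Open Scope R_scope.

(** * Functions of class [C^n] on the half-line *)

(** [Phi] is known only through its derivative and its limit, and [q] only as a supremum, so both
    must be characterized before anything is proved about them. [Derive] is total and says nothing
    where a derivative fails to exist; each level of [Cn] therefore carries an explicit derivative
    together with its proof. The curvature is computed for arbitrary [f] and [psi], before any
    equation for [Phi'] is imposed, so density and pressures are derived from the metric. For the
    decimals the critical point is not isolated: one rational near-maximizer gives the lower bound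
    by evaluation and the upper bound by a positivity certificate. *)

Fixpoint Cn (n : nat) (f : R -> R) : Prop :=
  match n with
  | O => forall r, 0 < r -> continuous f r
  | S k => exists g, (forall r, 0 < r -> is_derive f r (g r)) /\ Cn k g
  end.

(** For rewriting in the eta-expanded goals that [auto_derive] leaves. *)
Lemma Derive_eta (g : R -> R) (r l : R) : is_derive g r l -> Derive (fun s : R => g s) r = l.
Proof. exact (is_derive_unique g r l). Qed.

Lemma locally_pos (r : R) : 0 < r -> locally r (fun s => 0 < s).
Proof. intro Hr. exact (open_gt 0 r Hr). Qed.

Lemma Cn_continuous (n : nat) (f : R -> R) (r : R) :
  Cn n f -> 0 < r -> continuous f r.
Proof.
  destruct n as [|n]; simpl.
  - auto.
  - intros [g [Hg _]] Hr. apply (ex_derive_continuous f). exists (g r). auto.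
Qed.

Lemma Cn_S (n : nat) (f : R -> R) : Cn (S n) f -> Cn n f.
Proof.
  revert f. induction n as [|n IH]; intros f [g [Hg Cg]].
  - intros r Hr. apply (ex_derive_continuous f). exists (g r). auto.
  - exists g. auto.
Qed.

Lemma Cn_ext (n : nat) (f g : R -> R) :
  (forall r, 0 < r -> f r = g r) -> Cn n f -> Cn n g.
Proof.
  intros E. destruct n as [|n]; simpl.
  - intros Cf r Hr. apply continuous_ext_loc with f; auto.
    apply filter_imp with (2 := locally_pos r Hr). auto.
  - intros [d [Hd Cd]]. exists d. split; auto.
    intros r Hr. apply is_derive_ext_loc with f; auto.
    apply filter_imp with (2 := locally_pos r Hr). auto.
Qed.

Lemma Cn_const (n : nat) (c : R) : Cn n (fun _ => c).
Proof.
  revert c. induction n as [|n IH]; intro c.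
  - intros r _. apply continuous_const.
  - exists (fun _ => 0). split; auto. intros r _. apply @is_derive_const.
Qed.

Lemma Cn_id (n : nat) : Cn n (fun r => r).
Proof.
  destruct n as [|n].
  - intros r _. apply continuous_id.
  - exists (fun _ => 1). split; [|apply Cn_const]. intros r _. apply @is_derive_id.
Qed.

Lemma Cn_plus (n : nat) (f g : R -> R) : Cn n f -> Cn n g -> Cn n (fun r => f r + g r).
Proof.
  revert f g. induction n as [|n IH]; intros f g.
  - intros Cf Cg r Hr. apply @continuous_plus; auto.
  - intros [df [Hf Cf]] [dg [Hg Cg]]. exists (fun r => df r + dg r). split; auto.
    intros r Hr. apply @is_derive_plus; auto.
Qed.

Lemma Cn_mult (n : nat) (f g : R -> R) : Cn n f -> Cn n g -> Cn n (fun r => f r * g r).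
Proof.
  revert f g. induction n as [|n IH]; intros f g.
  - intros Cf Cg r Hr. apply @continuous_mult; auto.
  - intros Hf Hg. assert (Cf := Cn_S _ _ Hf). assert (Cg := Cn_S _ _ Hg).
    destruct Hf as [df [Hf Cdf]], Hg as [dg [Hg Cdg]].
    exists (fun r => df r * g r + f r * dg r). split.
    + intros r Hr. apply @is_derive_mult; auto. intros; apply Rmult_comm.
    + apply Cn_plus; auto.
Qed.

Lemma Cn_inv (n : nat) (f : R -> R) :
  (forall r, 0 < r -> f r <> 0) -> Cn n f -> Cn n (fun r => / f r).
Proof.
  intro Nf. induction n as [|n IH].
  - intros Cf r Hr. apply continuous_comp; auto.
    apply continuity_pt_filterlim. apply (continuity_pt_inv id).
    apply continuity_pt_id. now apply Nf.
  - intros Hf. assert (Cf := IH (Cn_S _ _ Hf)). destruct Hf as [df [Hf Cdf]].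
    exists (fun r => (-1 * df r) * (/ f r * / f r)). split.
    + intros r Hr. evar_last. apply is_derive_inv; auto. simpl. field. auto.
    + repeat apply Cn_mult; auto. apply Cn_const.
Qed.

Lemma Cn_exp (n : nat) (f : R -> R) : Cn n f -> Cn n (fun r => exp (f r)).
Proof.
  induction n as [|n IH].
  - intros Cf r Hr. apply continuous_comp; auto. apply continuous_exp.
  - intros Hf. assert (Cf := IH (Cn_S _ _ Hf)). destruct Hf as [df [Hf Cdf]].
    exists (fun r => df r * exp (f r)). split.
    + intros r Hr. apply (is_derive_comp exp f); auto. apply is_derive_exp.
    + apply Cn_mult; auto.
Qed.

(** Passage from derivative witnesses to [Derive_n]. The induction carries a function [g] that
    equals the [k]-th derivative on [r > 0] and still has class [n - k]; the half-line is open, so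
    equality on it transfers derivatives and continuity. *)
Lemma Cn_Derive_n (n k : nat) (f : R -> R) (r : R) :
  Cn n f -> (k <= n)%nat -> 0 < r ->
  ex_derive_n f k r /\ continuous (Derive_n f k) r.
Proof.
  intros Cf Hk.
  assert (H : exists g, Cn (n - k) g /\ forall s, 0 < s -> ex_derive_n f k s /\ Derive_n f k s = g s).
  { induction k as [|k IH].
    - exists f. rewrite Nat.sub_0_r. simpl. auto.
    - destruct IH as [g [Cg Hg]]. lia.
      replace (n - k)%nat with (S (n - S k)) in Cg by lia.
      destruct Cg as [d [Hd Cd]]. exists d. split; auto. intros s Hs.
      assert (D : is_derive (Derive_n f k) s (d s)).
      { apply is_derive_ext_loc with g; auto.
        apply filter_imp with (2 := locally_pos s Hs). intros t Ht. symmetry. now apply Hg. }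
      split. exists (d s); exact D. apply is_derive_unique. exact D. }
  destruct H as [g [Cg Hg]]. intro Hr. split. now apply Hg.
  apply continuous_ext_loc with g.
  - apply filter_imp with (2 := locally_pos r Hr). intros t Ht. symmetry. now apply Hg.
  - now apply Cn_continuous with (n - k)%nat.
Qed.

(** * Truncated powers and the normalized primitive *)

Lemma continuous_Rmax0 (t : R) : continuous (Rmax 0) t.
Proof.
  apply continuous_ext with (fun s => (s + Rabs s) / 2).
  - intro s. unfold Rmax, Rabs. destruct (Rcase_abs s), (Rle_dec 0 s); lra.
  - apply @continuous_mult; [|apply continuous_const].
    apply @continuous_plus; [apply continuous_id | apply continuous_Rabs].
Qed.

Lemma continuous_pow (k : nat) (f : R -> R) (t : R) :
  continuous f t -> continuous (fun s => f s ^ k) t.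
Proof.
  intro Cf. induction k as [|k IH]; simpl.
  - apply continuous_const.
  - apply @continuous_mult; auto.
Qed.

Lemma is_derive_Rmax0_pow (k : nat) (t : R) :
  is_derive (fun s => Rmax 0 s ^ S (S k)) t (INR (S (S k)) * Rmax 0 t ^ S k).
Proof.
  destruct (Rtotal_order t 0) as [Ht|[Ht|Ht]].
  - apply is_derive_ext_loc with (fun _ => 0).
    + apply filter_imp with (2 := open_lt 0 t Ht). intros s Hs.
      rewrite Rmax_left by lra. simpl; ring.
    + rewrite Rmax_left by lra. evar_last. apply @is_derive_const. simpl; unfold zero; simpl; ring.
  (* At the kink one factor [Rmax 0 s] may be replaced by [s], since both products vanish for
     [s <= 0]. The difference quotient is then [Rmax 0 h ^ S k], which tends to [0] by
     continuity. *)
  - subst t. apply is_derive_ext with (fun s => s * Rmax 0 s ^ S k).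
    + intro s. unfold Rmax; destruct (Rle_dec 0 s); simpl; ring.
    + apply is_derive_Reals. intros eps Heps.
      assert (C : continuous (fun s => Rmax 0 s ^ S k) 0)
        by apply continuous_pow, continuous_Rmax0.
      apply continuity_pt_filterlim in C.
      destruct (C eps Heps) as [d [Hd HC]].
      exists (mkposreal d Hd). intros h Hh Hhd. simpl in Hhd.
      rewrite (Rmax_left 0 0) by lra.
      specialize (HC h). simpl dist in HC. unfold R_dist, D_x, no_cond in HC.
      rewrite (Rmax_left 0 0) in HC by lra.
      replace (((0 + h) * Rmax 0 (0 + h) ^ S k - 0 * 0 ^ S k) / h - INR (S (S k)) * 0 ^ S k)
        with (Rmax 0 h ^ S k - 0 ^ S k).
      * apply HC. repeat split; auto. now rewrite Rminus_0_r.
      * rewrite Rplus_0_l. simpl (0 ^ S k). field. exact Hh.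
  - apply is_derive_ext_loc with (fun s => s ^ S (S k)).
    + apply filter_imp with (2 := open_gt 0 t Ht). intros s Hs.
      rewrite Rmax_right by lra. reflexivity.
    + rewrite Rmax_right by lra. evar_last. apply is_derive_pow. apply @is_derive_id.
      unfold one; simpl; ring.
Qed.

(** Each differentiation lowers the exponent by one, and exponent [1] is still continuous. *)
Lemma Cn_Rmax0_pow (n : nat) (w : R -> R) :
  (forall k, Cn k w) -> Cn n (fun r => Rmax 0 (w r) ^ S n).
Proof.
  intro Cw. induction n as [|n IH].
  - intros r Hr. apply continuous_pow. apply continuous_comp.
    + exact (Cw 0%nat r Hr).
    + apply continuous_Rmax0.
  - destruct (Cw (S n)) as [dw [Hw Cdw]].
    exists (fun r => dw r * (INR (S (S n)) * Rmax 0 (w r) ^ S n)). split.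
    + intros r Hr. apply (is_derive_comp (fun s => Rmax 0 s ^ S (S n)) w); auto.
      apply is_derive_Rmax0_pow.
    + apply Cn_mult; auto. apply Cn_mult; auto. apply Cn_const.
Qed.

(** Truncation at [0] makes [mass] the primitive of one expression on the whole
    line, so its smoothness at [L] and [eta * L] needs no gluing. *)
Definition bump (n : nat) (u : R) : R := Rmax 0 (u * (1 - u)) ^ n.

Lemma bump_inside (n : nat) (u : R) : 0 <= u <= 1 -> bump n u = u ^ n * (1 - u) ^ n.
Proof. intro Hu. unfold bump. rewrite Rmax_right by nra. apply Rpow_mult_distr. Qed.

Lemma bump_outside (n : nat) (u : R) : (1 <= n)%nat -> u <= 0 \/ 1 <= u -> bump n u = 0.
Proof.
  intros Hn Hu. unfold bump. rewrite Rmax_left by nra. apply pow_i. lia.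
Qed.

Lemma bump_nonneg (n : nat) (u : R) : 0 <= bump n u.
Proof. apply pow_le, Rmax_l. Qed.

Lemma bump_pos (n : nat) (u : R) : 0 < u < 1 -> 0 < bump n u.
Proof. intro Hu. apply pow_lt. rewrite Rmax_right; nra. Qed.

Lemma continuous_bump (n : nat) (u : R) : continuous (bump n) u.
Proof.
  apply continuous_pow. apply continuous_comp; [|apply continuous_Rmax0].
  apply @continuous_mult. apply continuous_id.
  apply @continuous_minus. apply continuous_const. apply continuous_id.
Qed.

Lemma ex_RInt_bump (n : nat) (a b : R) : ex_RInt (bump n) a b.
Proof. apply (ex_RInt_continuous (bump n)). intros; apply continuous_bump. Qed.

Lemma euler_beta_bump (n : nat) : euler_beta (n + 1) (n + 1) = RInt (bump n) 0 1.
Proof.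
  unfold euler_beta. apply RInt_ext. intros u Hu.
  rewrite Rmin_left, Rmax_right in Hu by lra.
  rewrite bump_inside by lra. now rewrite Nat.add_sub.
Qed.

Lemma euler_beta_pos (n : nat) : 0 < euler_beta (n + 1) (n + 1).
Proof.
  rewrite euler_beta_bump. apply RInt_gt_0. lra.
  intros; now apply bump_pos. intros; apply continuous_bump.
Qed.

(** Agrees with [F n] only on [[0,1]]; outside it is constant, unlike the polynomial [F n]. *)
Definition F_ext (n : nat) (x : R) : R := RInt (bump n) 0 x / euler_beta (n + 1) (n + 1).

Lemma is_derive_F_ext (n : nat) (x : R) :
  is_derive (F_ext n) x (bump n x / euler_beta (n + 1) (n + 1)).
Proof.
  apply (is_derive_scal_l (RInt (bump n) 0) x (bump n x) (/ euler_beta (n + 1) (n + 1))).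
  apply (is_derive_RInt (bump n) (RInt (bump n) 0) 0).
  - apply filter_forall. intro. apply (RInt_correct (bump n)), ex_RInt_bump.
  - apply continuous_bump.
Qed.

Lemma F_ext_inside (n : nat) (x : R) : 0 <= x <= 1 -> F_ext n x = F n x.
Proof.
  intro Hx. unfold F_ext, F. f_equal. apply RInt_ext. intros u Hu.
  rewrite Rmin_left, Rmax_right in Hu by lra. apply bump_inside. lra.
Qed.

Lemma F_ext_left (n : nat) (x : R) : (1 <= n)%nat -> x <= 0 -> F_ext n x = 0.
Proof.
  intros Hn Hx. unfold F_ext. rewrite (RInt_ext _ (fun _ => 0)).
  - rewrite RInt_const. unfold scal; simpl; unfold mult; simpl. unfold Rdiv; ring.
  - intros u Hu. rewrite Rmin_right, Rmax_left in Hu by lra. apply bump_outside; auto. lra.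
Qed.

Lemma F_ext_right (n : nat) (x : R) : (1 <= n)%nat -> 1 <= x -> F_ext n x = 1.
Proof.
  intros Hn Hx. unfold F_ext.
  rewrite <- (RInt_Chasles (bump n) 0 1 x) by apply ex_RInt_bump.
  rewrite (RInt_ext _ (fun _ => 0) 1 x).
  - rewrite RInt_const, <- euler_beta_bump. unfold scal, plus; simpl; unfold mult; simpl.
    assert (H := euler_beta_pos n). field. lra.
  - intros u Hu. rewrite Rmin_left, Rmax_right in Hu by lra. apply bump_outside; auto. lra.
Qed.

Lemma F_ext_incr (n : nat) (x y : R) : x <= y -> F_ext n x <= F_ext n y.
Proof.
  intro H. unfold F_ext. assert (B := euler_beta_pos n).
  apply Rmult_le_compat_r. left; now apply Rinv_0_lt_compat.
  rewrite <- (RInt_Chasles (bump n) 0 x y) by apply ex_RInt_bump.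
  assert (0 <= RInt (bump n) x y).
  { apply RInt_ge_0; auto. apply ex_RInt_bump. intros; apply bump_nonneg. }
  unfold plus; simpl. lra.
Qed.

Lemma F_ext_bounds (n : nat) (x : R) : (1 <= n)%nat -> 0 <= F_ext n x <= 1.
Proof.
  intro Hn. split.
  - rewrite <- (F_ext_left n (Rmin 0 x)) by (auto using Rmin_l). apply F_ext_incr, Rmin_r.
  - rewrite <- (F_ext_right n (Rmax 1 x)) by (auto using Rmax_l). apply F_ext_incr, Rmax_r.
Qed.

Lemma F_ext_pos (n : nat) (x : R) : 0 < x -> 0 < F_ext n x.
Proof.
  intro Hx. apply Rlt_le_trans with (F_ext n (Rmin x 1)); [|apply F_ext_incr, Rmin_l].
  assert (0 < Rmin x 1 <= 1). { split. apply Rmin_glb_lt; lra. apply Rmin_r. }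
  apply Rdiv_lt_0_compat; [|apply euler_beta_pos].
  apply RInt_gt_0. lra. intros; apply bump_pos; lra. intros; apply continuous_bump.
Qed.

(** * The mass function and its compactness *)

Definition shell_coord (eta L r : R) : R := (r / L - 1) / (eta - 1).

Lemma mass_F_ext (n : nat) (eta L M r : R) : (1 <= n)%nat -> 1 < eta -> 0 < L ->
  mass n eta L M r = M * F_ext n (shell_coord eta L r).
Proof.
  intros Hn He HL. unfold mass, shell_coord.
  assert (E : r / L * L = r) by (field; lra).
  set (x := (r / L - 1) / (eta - 1)).
  (* In the coordinate [x] the three regions are [x <= 0], [0 < x < 1] and [1 <= x]; in each case a
     wrong sign of [x] or [x - 1] is refuted by the sign of a product. *)
  assert (Ex : r = L * (1 + x * (eta - 1))) by (unfold x; field; lra).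
  destruct (Rle_dec r L) as [H|H].
  - rewrite F_ext_left; auto. ring.
    apply Rnot_lt_le. intro C. assert (0 < L * (x * (eta - 1)))
        by (apply Rmult_lt_0_compat; [|apply Rmult_lt_0_compat]; lra).
      lra.
  - assert (0 < x).
    { apply Rnot_le_lt. intro C. assert (0 <= L * (- x * (eta - 1)))
        by (apply Rmult_le_pos; [|apply Rmult_le_pos]; lra).
      lra. }
    destruct (Rlt_dec r (eta * L)) as [H'|H'].
    + rewrite F_ext_inside; auto. split. lra. apply Rnot_lt_le. intro C.
      assert (0 < L * ((x - 1) * (eta - 1)))
        by (apply Rmult_lt_0_compat; [|apply Rmult_lt_0_compat]; lra).
      lra.
    + rewrite F_ext_right; auto. ring. apply Rnot_lt_le. intro C.
      assert (0 < L * ((1 - x) * (eta - 1)))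
        by (apply Rmult_lt_0_compat; [|apply Rmult_lt_0_compat]; lra).
      lra.
Qed.

Definition mass' (n : nat) (eta L M r : R) : R :=
  M / (L * (eta - 1)) / euler_beta (n + 1) (n + 1) * bump n (shell_coord eta L r).

Lemma is_derive_mass (n : nat) (eta L M r : R) : (1 <= n)%nat -> 1 < eta -> 0 < L ->
  is_derive (mass n eta L M) r (mass' n eta L M r).
Proof.
  intros Hn He HL.
  apply is_derive_ext with (fun s => M * F_ext n (shell_coord eta L s)).
  { intro s. symmetry. now apply mass_F_ext. }
  evar_last.
  - apply is_derive_scal. apply (is_derive_comp (F_ext n) (shell_coord eta L)).
    + apply is_derive_F_ext.
    + unfold shell_coord. auto_derive. auto. reflexivity.
  - assert (B := euler_beta_pos n). unfold mass', scal; simpl; unfold mult; simpl. field. lra.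
Qed.

Lemma Cn_mass' (n : nat) (eta L M : R) : Cn n (mass' (S n) eta L M).
Proof.
  apply Cn_mult. apply Cn_const. apply Cn_Rmax0_pow. intro k.
  assert (C : Cn k (shell_coord eta L)).
  { apply Cn_ext with (fun r => (r * / L + -1) * / (eta - 1)).
    - intros; unfold shell_coord; unfold Rdiv; ring.
    - auto using Cn_mult, Cn_plus, Cn_const, Cn_id. }
  apply Cn_ext with (fun r => shell_coord eta L r * (1 + -1 * shell_coord eta L r)).
  - intros; ring.
  - auto using Cn_mult, Cn_plus, Cn_const.
Qed.

Lemma Cn_mass (n : nat) (eta L M : R) : (1 <= n)%nat -> 1 < eta -> 0 < L ->
  Cn n (mass n eta L M).
Proof.
  intros Hn He HL. destruct n as [|n]; [lia|].
  exists (mass' (S n) eta L M). split.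
  - intros r _. now apply is_derive_mass.
  - apply Cn_mass'.
Qed.

Lemma compactness_F_ext (n : nat) (eta y : R) : 1 < eta -> 1 <= y <= eta ->
  compactness n eta y = F_ext n ((y - 1) / (eta - 1)) / y.
Proof.
  intros He Hy. unfold compactness. rewrite F_ext_inside; auto.
  split; [apply Rdiv_le_0_compat; lra|]. apply Rle_div_l; lra.
Qed.

(** An attained upper bound is the least one. This frees later arguments from the encoding of [q]
    through [Lub_Rbar]. *)
Lemma is_max_on_q_unique (n : nat) (eta v : R) :
  is_max_on (compactness n eta) 1 eta v -> q n eta = v.
Proof.
  intros [[y [Hy <-]] Hmax]. unfold q.
  rewrite (is_lub_Rbar_unique _ (compactness n eta y)); [reflexivity|]. split.
  - intros v [z [Hz ->]]. simpl. auto.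
  - intros b Hb. apply Hb. exists y. auto.
Qed.

Lemma is_max_on_q (n : nat) (eta : R) : 1 < eta ->
  is_max_on (compactness n eta) 1 eta (q n eta).
Proof.
  (* The derivative of [F_ext] is known at every point, which gives continuity at the endpoints too;
     [g] agrees with [compactness] on [[1, eta]]. *)
  intros He. pose (g := fun y => F_ext n ((y - 1) / (eta - 1)) / y).
  destruct (continuity_ab_maj g 1 eta) as [y [Hmax Hy]].
  - lra.
  - intros c Hc. apply continuity_pt_filterlim. apply (ex_derive_continuous g).
    unfold g. auto_derive. repeat split; try lra. eexists. apply is_derive_F_ext.
  - assert (M : is_max_on (compactness n eta) 1 eta (compactness n eta y)).
    { split. exists y; auto. intros z Hz. rewrite !compactness_F_ext by auto. now apply Hmax. }
    now rewrite (is_max_on_q_unique _ _ _ M).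
Qed.

Lemma q_pos (n : nat) (eta : R) : 1 < eta -> 0 < q n eta.
Proof.
  intros He. apply Rlt_le_trans with (compactness n eta eta).
  - rewrite compactness_F_ext by lra. apply Rdiv_lt_0_compat; [|lra].
    apply F_ext_pos. apply Rdiv_lt_0_compat; lra.
  - apply (is_max_on_q n eta He). lra.
Qed.

Lemma mass_compactness (n : nat) (eta L M y : R) : (1 <= n)%nat -> 1 < eta -> 0 < L ->
  1 <= y <= eta -> mass n eta L M (y * L) = M * y * compactness n eta y.
Proof.
  intros Hn He HL Hy. rewrite mass_F_ext, compactness_F_ext by auto.
  unfold shell_coord. replace (y * L / L) with y by (field; lra). field. lra.
Qed.

Lemma mass_cavity (n : nat) (eta L M r : R) : r <= L -> mass n eta L M r = 0.
Proof. intro Hr. unfold mass. destruct (Rle_dec r L); lra. Qed.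

Lemma mass_exterior (n : nat) (eta L M r : R) : 1 < eta -> 0 < L -> eta * L <= r ->
  mass n eta L M r = M.
Proof.
  intros He HL Hr. unfold mass. destruct (Rle_dec r L); [nra|].
  destruct (Rlt_dec r (eta * L)); lra.
Qed.

Lemma mass_nonneg (n : nat) (eta L M r : R) : (1 <= n)%nat -> 1 < eta -> 0 < L -> 0 < M ->
  0 <= mass n eta L M r.
Proof.
  intros Hn He HL HM. rewrite mass_F_ext by auto.
  apply Rmult_le_pos; [lra|]. now apply F_ext_bounds.
Qed.

(** In the cavity [m] vanishes, in the shell [m / r] is [M / L] times the compactness, and beyond
    [eta * L] the mass is constant while [r] grows, so the ratio there is largest at the
    junction. *)
Lemma mass_le_q (n : nat) (eta L M r : R) : (1 <= n)%nat -> 1 < eta -> 0 < L -> 0 < M ->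
  0 < r -> mass n eta L M r <= q n eta * (M / L) * r.
Proof.
  intros Hn He HL HM Hr. assert (Q := q_pos n eta He).
  destruct (is_max_on_q n eta He) as [_ Hmax].
  assert (HML : 0 < M / L) by (apply Rdiv_lt_0_compat; lra).
  destruct (Rle_dec r L) as [H|H].
  { rewrite mass_cavity by auto. apply Rmult_le_pos; nra. }
  (* The premise [y * L <= r], in place of equality, lets [y = eta] serve the whole exterior. *)
  assert (B : forall y, 1 <= y <= eta -> y * L <= r -> mass n eta L M (y * L) <= q n eta * (M / L) * r).
  { intros y Hy Hyr. rewrite mass_compactness by auto.
    apply Rle_trans with (q n eta * (M / L) * (y * L)).
    - replace (q n eta * (M / L) * (y * L)) with (M * y * q n eta) by (field; lra).
      apply Rmult_le_compat_l; [nra | auto].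
    - apply Rmult_le_compat_l; nra. }
  destruct (Rle_dec (eta * L) r) as [H'|H'].
  - rewrite <- (B eta) by lra. rewrite !mass_exterior by lra. lra.
  - replace r with (r / L * L) at 1 by (field; lra). apply B.
    + split. apply Rle_div_r; lra. apply Rle_div_l; lra.
    + right. field. lra.
Qed.

Lemma mass_DEC (n : nat) (eta L M r : R) : (1 <= n)%nat -> 1 < eta -> 0 < L -> 0 < M ->
  0 < r -> M / L <= mu_DEC n eta -> 5 * mass n eta L M r <= 2 * r.
Proof.
  intros Hn He HL HM Hr Hmu. assert (Q := q_pos n eta He).
  assert (B := mass_le_q n eta L M r Hn He HL HM Hr).
  assert (q n eta * (M / L) <= 0.4).
  { unfold mu_DEC in Hmu. apply Rle_div_r in Hmu; lra. }
  nra.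
Qed.

Lemma mass_DEC_strict (n : nat) (eta L M r : R) : (1 <= n)%nat -> 1 < eta -> 0 < L -> 0 < M ->
  0 < r -> M / L < mu_DEC n eta -> 5 * mass n eta L M r < 2 * r.
Proof.
  intros Hn He HL HM Hr Hmu. assert (Q := q_pos n eta He).
  assert (B := mass_le_q n eta L M r Hn He HL HM Hr).
  assert (q n eta * (M / L) < 0.4).
  { unfold mu_DEC in Hmu. apply Rlt_div_r in Hmu; lra. }
  nra.
Qed.

(** The minimum of [2 r - 5 m] is attained at the saturation radius, so
    [m' = 2 / 5] there. *)
Lemma mass_saturated (n : nat) (eta L M : R) : (1 <= n)%nat -> 1 < eta -> 0 < L -> 0 < M ->
  M / L = mu_DEC n eta ->
  exists r, 0 < r /\ 5 * mass n eta L M r = 2 * r /\ 5 * Derive (mass n eta L M) r = 2.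
Proof.
  intros Hn He HL HM Hmu. assert (Q := q_pos n eta He).
  destruct (is_max_on_q n eta He) as [[y [Hy Ey]] _].
  assert (Hr : 0 < y * L) by nra.
  assert (E : 5 * mass n eta L M (y * L) = 2 * (y * L)).
  { rewrite mass_compactness, Ey by auto.
    replace M with (mu_DEC n eta * L) by (rewrite <- Hmu; field; lra).
    unfold mu_DEC. replace 0.4 with (2 / 5) by lra. field. lra. }
  exists (y * L). split; [|split]; auto.
  pose (g := fun r => 2 * r - 5 * mass n eta L M r).
  assert (D : is_derive g (y * L) (2 - 5 * Derive (mass n eta L M) (y * L))).
  { assert (ED := is_derive_mass n eta L M (y * L) Hn He HL).
    unfold g. auto_derive. eexists; exact ED.
    rewrite (Derive_eta _ _ _ ED). rewrite (is_derive_unique _ _ _ ED). ring. }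
  apply is_derive_Reals in D.
  (* The minimum is taken over all [r > 0], not only over the shell, so a maximizer at an endpoint
     of [[1, eta]] needs no separate case; [y * L + 1] is just some point further right. *)
  assert (Z := deriv_minimum g 0 (y * L + 1) (y * L) (exist _ _ D)).
  simpl in Z. enough (2 - 5 * Derive (mass n eta L M) (y * L) = 0) by lra.
  apply Z; try lra. intros r Hr0 _. unfold g. rewrite E.
  assert (B := mass_DEC n eta L M r Hn He HL HM Hr0 (Req_le _ _ Hmu)). lra.
Qed.

(** * Numerical values for [n = 4], [eta = 3] *)

(** The primitive of [u^4 (1 - u)^4] multiplied by [1 / B(5,5) = 630]. *)
Definition F4_poly (x : R) : R :=
  126 * x ^ 5 - 420 * x ^ 6 + 540 * x ^ 7 - 315 * x ^ 8 + 70 * x ^ 9.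

Lemma F_4 (x : R) : F 4 x = F4_poly x.
Proof.
  assert (I : forall y, RInt (fun u => u ^ 4 * (1 - u) ^ 4) 0 y = F4_poly y / 630).
  { intro y. apply is_RInt_unique. evar_last.
    - apply (is_RInt_derive (fun u => F4_poly u / 630) (fun u => u ^ 4 * (1 - u) ^ 4)).
      + intros u _. unfold F4_poly. auto_derive; auto. simpl. field.
      + intros u _. apply (ex_derive_continuous (fun u => u ^ 4 * (1 - u) ^ 4)). auto_derive. auto.
    - unfold minus, plus, opp, F4_poly; simpl. field. }
  unfold F, euler_beta. simpl Nat.sub. rewrite !I. unfold F4_poly. field.
Qed.

(** Just below [0.380436713749]; the slack over the maximum absorbs the error of the rational
    near-maximizer. *)
Definition q43_upper : R := 3804367137489 / 10 ^ 13.

(** With [x = (y - 1) / 2], so that [y = 1 + 2 x], this is [compactness 4 3 y <= q43_upper] cleared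
    of its denominator. *)
Lemma F4_poly_le (x : R) : 0 <= x <= 1 -> F4_poly x <= q43_upper * (1 + 2 * x).
Proof.
  intro Hx.
  pose (a := 769428 / 1022971).
  pose (d0 := q43_upper * (1 + 2 * a) - F4_poly a).
  pose (d1 := 2 * q43_upper
              - (630 * a ^ 4 - 2520 * a ^ 5 + 3780 * a ^ 6 - 2520 * a ^ 7 + 630 * a ^ 8)).
  (* Quotient of [q43_upper * (1 + 2 * x) - F4_poly x] by [(x - a)^2]. If [p_j] is the coefficient
     of [x^j], then [e_k = p_(k+2) + 2 a e_(k+1) - a^2 e_(k+2)], starting from the leading
     coefficient [-70]; [p_2], [p_3], [p_4] vanish. *)
  pose (e3 := - 126 + 2 * a * 420 - 3 * a ^ 2 * 540 + 4 * a ^ 3 * 315 - 5 * a ^ 4 * 70).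
  pose (e4 := 420 - 2 * a * 540 + 3 * a ^ 2 * 315 - 4 * a ^ 3 * 70).
  pose (e5 := - 540 + 2 * a * 315 - 3 * a ^ 2 * 70).
  pose (e6 := 315 - 2 * a * 70).
  pose (e2 := 2 * a * e3 - a ^ 2 * e4).
  pose (e1 := 2 * a * e2 - a ^ 2 * e3).
  pose (e0 := 2 * a * e1 - a ^ 2 * e2).
  (* [a] approximates the maximizer, so Taylor expansion at [a] leaves a
     quadratic remainder plus an affine term that is positive on [[0,1]]. *)
  assert (T : q43_upper * (1 + 2 * x) - F4_poly x
    = (x - a) ^ 2 * (e0 + e1 * x + e2 * x ^ 2 + e3 * x ^ 3 + e4 * x ^ 4 + e5 * x ^ 5
                     + e6 * x ^ 6 - 70 * x ^ 7) + (d0 + d1 * (x - a))).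
  { unfold e0, e1, e2, e3, e4, e5, e6, d0, d1, F4_poly. ring. }
  assert (D : 0 <= d0 + d1 * (x - a)).
  (* An affine function nonnegative at [x = 0] and at [x = 1] is nonnegative in between. *)
  { assert (0 <= d0 - d1 * a /\ 0 <= d0 + d1 * (1 - a)) as [A B].
    { unfold d0, d1, F4_poly, q43_upper, a. lra. }
    nra. }
  assert (E3 : 13.45 <= e3) by (unfold e3, a; lra).
  assert (E4 : 23.14 <= e4) by (unfold e4, a; lra).
  assert (E5 : -184.95 <= e5) by (unfold e5, a; lra).
  assert (E6 : 209.69 <= e6) by (unfold e6, a; lra).
  assert (E2 : 7.14 <= e2) by (unfold e2, e3, e4, a; lra).
  assert (E1 : 3.13 <= e1) by (unfold e1, e2, e3, e4, a; lra).
  assert (E0 : 0.67 <= e0) by (unfold e0, e1, e2, e3, e4, a; lra).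
  assert (P : forall k, 0 <= x ^ k) by (intro; apply pow_le; lra).
  assert (P' : forall k, 0 <= (1 - x) ^ k) by (intro; apply pow_le; lra).
  assert (Q : 0 <= e0 + e1 * x + e2 * x ^ 2 + e3 * x ^ 3 + e4 * x ^ 4 + e5 * x ^ 5
                     + e6 * x ^ 6 - 70 * x ^ 7).
  { apply Rle_trans with (0.67 + 3.13 * x + 7.14 * x ^ 2 + 13.45 * x ^ 3 + 23.14 * x ^ 4
                          - 184.95 * x ^ 5 + 209.69 * x ^ 6 - 70 * x ^ 7).
    - (* The coefficients in the Bernstein basis of degree 7 are positive. *)
      assert (B : forall i j c, 0 <= c -> 0 <= c * (x ^ i * (1 - x) ^ j))
        by (intros; repeat apply Rmult_le_pos; auto).
      generalize (B 0%nat 7%nat 0.67) (B 1%nat 6%nat 7.82) (B 2%nat 5%nat 39.99)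
        (B 3%nat 4%nat 119.55) (B 4%nat 3%nat 234.39) (B 5%nat 2%nat 97.59)
        (B 6%nat 1%nat 22.18) (B 7%nat 0%nat 2.27). lra.
    - assert (H : forall c e k, c <= e -> c * x ^ k <= e * x ^ k)
        by (intros; apply Rmult_le_compat_r; auto).
      generalize (H _ _ 1%nat E1) (H _ _ 2%nat E2) (H _ _ 3%nat E3) (H _ _ 4%nat E4)
        (H _ _ 5%nat E5) (H _ _ 6%nat E6). rewrite pow_1. lra. }
  assert (0 <= (x - a) ^ 2) by apply pow2_ge_0.
  assert (S := Rmult_le_pos _ _ H Q). lra.
Qed.

Lemma q_4_3_upper : q 4 3 <= q43_upper.
Proof.
  destruct (is_max_on_q 4 3) as [[y [Hy <-]] _]; [lra|].
  unfold compactness. rewrite F_4. apply Rle_div_l; [lra|].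
  replace y with (1 + 2 * ((y - 1) / (3 - 1))) at 2 by field.
  apply F4_poly_le. replace (3 - 1) with 2 by ring. lra.
Qed.

Definition q43_lower : R := 38043671374857 / 10 ^ 14.

(** One evaluation bounds a maximum from below; the point is the near-maximizer [a] of
    [F4_poly_le]. *)
Lemma q_4_3_lower : q43_lower <= q 4 3.
Proof.
  destruct (is_max_on_q 4 3) as [_ H]; [lra|].
  apply Rle_trans with (compactness 4 3 (1 + 2 * (769428 / 1022971))).
  - unfold compactness. rewrite F_4. apply Rle_div_r; [lra|].
    replace ((1 + 2 * (769428 / 1022971) - 1) / (3 - 1)) with (769428 / 1022971) by field.
    unfold q43_lower, F4_poly. lra.
  - apply H. lra.
Qed.

(** [0.4 / q] decreases in [q], so each bound on [q] gives the opposite bound on [mu_DEC]. Twelve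
    decimals of [mu_DEC] require [q] to within about [4e-13], hence the extra digits of the two
    bounds. *)
Lemma q_4_3_digits :
  0.380436713748 <= q 4 3 < 0.380436713749 /\
  1.051423234257 <= mu_DEC 4 3 < 1.051423234258.
Proof.
  assert (U := q_4_3_upper). assert (L := q_4_3_lower). unfold q43_upper in U. unfold q43_lower in L.
  unfold mu_DEC. split; [lra|]. split.
  - apply (Rle_div_r 1.051423234257 0.4); lra.
  - apply (Rlt_div_l 0.4 1.051423234258); lra.
Qed.

(** * Curvature of the static spherical metric *)

Lemma update_same (x : event) (a : coord) (s : R) : update x a s a = s.
Proof. unfold update. destruct (coord_eq_dec a a); congruence. Qed.

Lemma update_other (x : event) (a b : coord) (s : R) : a <> b -> update x a s b = x b.
Proof. unfold update. destruct (coord_eq_dec b a); congruence. Qed.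

Lemma in_chart_update (x : event) (a : coord) :
  in_chart x -> locally (x a) (fun s => in_chart (update x a s)).
Proof.
  intros [Hr [H0 HP]]. unfold in_chart. destruct a.
  - apply filter_forall. intro s. rewrite !update_other by discriminate. auto.
  - apply filter_imp with (2 := open_gt 0 (x Rad) Hr). intros s Hs.
    rewrite update_same, update_other by discriminate. auto.
  - generalize (filter_and _ _ (open_gt 0 (x Theta) H0) (open_lt PI (x Theta) HP)).
    apply filter_imp. intros s Hs. rewrite update_same, update_other by discriminate. auto.
  - apply filter_forall. intro s. rewrite !update_other by discriminate. auto.
Qed.

(** The chart is open along every coordinate line, so [christoffel] may be replaced by its closed
    form before it is differentiated. *)
Lemma partial_ext (a : coord) (f g : event -> R) (x : event) :
  in_chart x -> (forall y, in_chart y -> f y = g y) -> partial a f x = partial a g x.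
Proof.
  intros Hx E. apply Derive_ext_loc. apply filter_imp with (2 := in_chart_update x a Hx).
  intros s Hs. now apply E.
Qed.

Lemma partial_unique (a : coord) (f : event -> R) (x : event) (l : R) :
  is_derive (fun s => f (update x a s)) (x a) l -> partial a f x = l.
Proof. apply is_derive_unique. Qed.

Section Curvature.

(* [psi] and [f] stand for [Phi'] and [1 - 2 m / r]. *)
Variables Phi m psi f psi' f' : R -> R.
Hypothesis Hf : forall r, blackening m r = f r.
Hypothesis Hpos : forall r, 0 < r -> 0 < f r.
Hypothesis dPhi : forall r, 0 < r -> is_derive Phi r (psi r).
Hypothesis dpsi : forall r, 0 < r -> is_derive psi r (psi' r).
Hypothesis df : forall r, 0 < r -> is_derive f r (f' r).

Definition metric_partial (b c s : coord) (x : event) : R :=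
  let r := x Rad in
  match b, c, s with
  | Rad, Tau, Tau => - (2 * psi r * exp (2 * Phi r))
  | Rad, Rad, Rad => - f' r / f r ^ 2
  | Rad, Theta, Theta => 2 * r
  | Rad, Varphi, Varphi => 2 * r * sin (x Theta) ^ 2
  | Theta, Varphi, Varphi => r ^ 2 * (2 * sin (x Theta) * cos (x Theta))
  | _, _, _ => 0
  end.

Ltac eval_update := cbv [metric metric_partial update coord_eq_dec coord_rec coord_rect sumbool_rec sumbool_rect].
Ltac is_const := match goal with |- is_derive (fun _ => _) _ 0 => apply @is_derive_const end.

Lemma partial_metric (b c s : coord) (x : event) : in_chart x ->
  partial b (fun z => metric Phi m z c s) x = metric_partial b c s x.
Proof.
  intros [Hr Ht]. apply partial_unique.
  assert (P := dPhi _ Hr). assert (D := df _ Hr). assert (Q := Hpos _ Hr).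
  destruct b, c, s; eval_update; try is_const.
  - unfold g_tt. auto_derive. exists (psi (x Rad)); exact P.
    rewrite (Derive_eta Phi _ _ P). ring.
  - unfold g_rr. apply is_derive_ext with (fun r => / f r). intro; now rewrite Hf.
    apply is_derive_inv; auto. lra.
  - auto_derive; auto. ring.
  - auto_derive; auto. ring.
  - auto_derive; auto. ring.
Qed.

Definition Gamma (a b c : coord) (x : event) : R :=
  let r := x Rad in
  match a, b, c with
  | Tau, Tau, Rad | Tau, Rad, Tau => psi r
  | Rad, Tau, Tau => f r * psi r * exp (2 * Phi r)
  | Rad, Rad, Rad => - f' r / (2 * f r)
  | Rad, Theta, Theta => - (r * f r)
  | Rad, Varphi, Varphi => - (r * f r * sin (x Theta) ^ 2)
  | Theta, Theta, Rad | Theta, Rad, Theta | Varphi, Varphi, Rad | Varphi, Rad, Varphi => / r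
  | Theta, Varphi, Varphi => - (sin (x Theta) * cos (x Theta))
  | Varphi, Theta, Varphi | Varphi, Varphi, Theta => cos (x Theta) / sin (x Theta)
  | _, _, _ => 0
  end.

Lemma christoffel_metric (a b c : coord) (x : event) : in_chart x ->
  christoffel (metric Phi m) a b c x = Gamma a b c x.
Proof.
  intros Hx. unfold christoffel, sum_coord. rewrite !partial_metric by exact Hx.
  destruct Hx as [Hr Ht]. assert (Q := Hpos _ Hr).
  assert (S := sin_gt_0 (x Theta) (proj1 Ht) (proj2 Ht)).
  assert (E := exp_pos (2 * Phi (x Rad))).
  destruct a; unfold inverse_diag; simpl; unfold g_tt, g_rr; rewrite ?Hf;
    destruct b, c; unfold metric_partial, Gamma; field; lra.
Qed.

(** The coordinate derivative [d_d Gamma^a_{bc}], except for the component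
    [d_r Gamma^r_{rr}], which cancels out of the curvature and need not exist. *)
Definition Gamma_partial (d a b c : coord) (x : event) : R :=
  let r := x Rad in
  match d, a, b, c with
  | Rad, Tau, Tau, Rad | Rad, Tau, Rad, Tau => psi' r
  | Rad, Rad, Tau, Tau => (f' r * psi r + f r * psi' r + 2 * f r * psi r ^ 2) * exp (2 * Phi r)
  | Rad, Rad, Rad, Rad => partial Rad (Gamma Rad Rad Rad) x
  | Rad, Rad, Theta, Theta => - (f r + r * f' r)
  | Rad, Rad, Varphi, Varphi => - ((f r + r * f' r) * sin (x Theta) ^ 2)
  | Theta, Rad, Varphi, Varphi => - (r * f r * (2 * sin (x Theta) * cos (x Theta)))
  | Rad, Theta, Theta, Rad | Rad, Theta, Rad, Theta
  | Rad, Varphi, Varphi, Rad | Rad, Varphi, Rad, Varphi => - / r ^ 2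
  | Theta, Theta, Varphi, Varphi => sin (x Theta) ^ 2 - cos (x Theta) ^ 2
  | Theta, Varphi, Theta, Varphi | Theta, Varphi, Varphi, Theta =>
      - 1 - (cos (x Theta) / sin (x Theta)) ^ 2
  | _, _, _, _ => 0
  end.

Lemma partial_christoffel (d a b c : coord) (x : event) : in_chart x ->
  partial d (christoffel (metric Phi m) a b c) x = Gamma_partial d a b c x.
Proof.
  intros Hx. rewrite (partial_ext d _ (Gamma a b c)); auto using christoffel_metric.
  destruct Hx as [Hr Ht].
  assert (P := dPhi _ Hr). assert (P' := dpsi _ Hr). assert (D := df _ Hr).
  assert (Q := Hpos _ Hr).
  assert (S := sin_gt_0 (x Theta) (proj1 Ht) (proj2 Ht)).
  (* [reflexivity] disposes of [d_r Gamma^r_{rr}], which the table leaves unevaluated. *)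
  destruct d, a, b, c; unfold Gamma_partial; try reflexivity;
    apply partial_unique; unfold Gamma; eval_update; try is_const.
  all: try assumption.
  all: auto_derive; 
    [ repeat split; solve [lra | eexists; eassumption] |
      rewrite ?(Derive_eta Phi _ _ P), ?(Derive_eta psi _ _ P'),
       ?(Derive_eta f _ _ D); field; lra].
Qed.

Definition ricci_diag (a : coord) (x : event) : R :=
  let r := x Rad in
  match a with
  | Tau => exp (2 * Phi r)
      * (f r * (psi' r + psi r ^ 2) + f' r * psi r / 2 + 2 * f r * psi r / r)
  | Rad => - (psi' r + psi r ^ 2) - f' r * psi r / (2 * f r) - f' r / (r * f r)
  | Theta => 1 - f r - r * f' r / 2 - r * f r * psi r
  | Varphi => (1 - f r - r * f' r / 2 - r * f r * psi r) * sin (x Theta) ^ 2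
  end.

(** The tabulated derivatives are written, for instance [-1 - cot^2] for that of [cot], so that all
    cancellations are rational in [sin] and [cos], and [field] needs no Pythagorean identity. The
    unevaluated [d_r Gamma^r_{rr}] occurs twice in [R^r_{rrr}], with opposite signs. *)
Lemma ricci_metric (b d : coord) (x : event) : in_chart x ->
  ricci (metric Phi m) x b d = if coord_eq_dec b d then ricci_diag b x else 0.
Proof.
  intros Hx. unfold ricci, riemann, sum_coord.
  rewrite !partial_christoffel, !christoffel_metric by exact Hx.
  destruct Hx as [Hr Ht]. assert (Q := Hpos _ Hr).
  assert (S := sin_gt_0 (x Theta) (proj1 Ht) (proj2 Ht)).
  destruct b, d; simpl; field; lra.
Qed.

Lemma scalar_curvature_metric (x : event) : in_chart x ->
  let r := x Rad in
  scalar_curvature (metric Phi m) x =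
  - 2 * f r * (psi' r + psi r ^ 2) - f' r * psi r - 4 * f r * psi r / r
  - 2 * f' r / r + 2 * (1 - f r) / r ^ 2.
Proof.
  intros Hx. unfold scalar_curvature, sum_coord. rewrite !ricci_metric by exact Hx.
  destruct Hx as [Hr Ht]. assert (Q := Hpos _ Hr).
  assert (S := sin_gt_0 (x Theta) (proj1 Ht) (proj2 Ht)).
  assert (E := exp_pos (2 * Phi (x Rad))).
  unfold inverse_diag; simpl. unfold g_tt, g_rr. rewrite Hf. field. lra.
Qed.

(** [8 * PI] times the density and the pressures, in terms of [f] and [psi]. *)
Definition einstein_frame_diag (a : coord) (r : R) : R :=
  match a with
  | Tau => (1 - f r - r * f' r) / r ^ 2
  | Rad => (f r - 1) / r ^ 2 + 2 * f r * psi r / r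
  | Theta | Varphi =>
      f r * (psi' r + psi r ^ 2 + psi r / r) + f' r / 2 * (psi r + 1 / r)
  end.

(** The factor [|g_aa|] is pulled out because the two frame factors [|g_aa|^(-1/2)] remove exactly
    it. *)
Lemma einstein_metric (a b : coord) (x : event) : in_chart x ->
  einstein (metric Phi m) x a b =
  if coord_eq_dec a b then Rabs (metric Phi m x a a) * einstein_frame_diag a (x Rad) else 0.
Proof.
  intros Hx. unfold einstein.
  rewrite ricci_metric, scalar_curvature_metric by exact Hx.
  destruct Hx as [Hr Ht]. assert (Q := Hpos _ Hr).
  assert (S := sin_gt_0 (x Theta) (proj1 Ht) (proj2 Ht)).
  assert (E := exp_pos (2 * Phi (x Rad))).
  destruct a, b; simpl; unfold g_tt, g_rr; rewrite ?Hf; try ring.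
  - rewrite Rabs_Ropp, Rabs_pos_eq by lra. field. lra.
  - rewrite Rabs_pos_eq by (left; now apply Rinv_0_lt_compat). field. lra.
  - rewrite Rabs_pos_eq by nra. field. lra.
  - rewrite Rabs_pos_eq by (apply Rmult_le_pos; nra). field. lra.
Qed.

Lemma frame_stress_energy_metric (a b : coord) (x : event) : in_chart x ->
  frame_components (metric Phi m) (stress_energy (metric Phi m)) x a b =
  if coord_eq_dec a b then einstein_frame_diag a (x Rad) / (8 * PI) else 0.
Proof.
  intros Hx. unfold frame_components, stress_energy. rewrite einstein_metric by exact Hx.
  destruct (coord_eq_dec a b) as [<-|N]; [|unfold Rdiv; ring].
  rewrite sqrt_sqrt by apply Rabs_pos.
  assert (N : Rabs (metric Phi m x a a) <> 0).
  { apply Rabs_no_R0. destruct Hx as [Hr Ht]. assert (Q := Hpos _ Hr).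
    assert (S := sin_gt_0 (x Theta) (proj1 Ht) (proj2 Ht)).
    assert (E := exp_pos (2 * Phi (x Rad))).
    destruct a; simpl; unfold g_tt, g_rr; rewrite ?Hf.
    - lra.
    - now apply Rinv_neq_0_compat, Rgt_not_eq.
    - nra.
    - apply Rmult_integral_contrapositive; split; nra. }
  field. split; auto. apply PI_neq0.
Qed.
End Curvature.

Lemma is_derive_blackening (m : R -> R) (r : R) : 0 < r -> ex_derive m r ->
  is_derive (blackening m) r (- (2 * Derive m r) / r + 2 * m r / r ^ 2).
Proof.
  intros Hr Dm. unfold blackening. auto_derive.
  - split; auto. lra.
  - rewrite (Derive_eta m _ _ (Derive_correct _ _ Dm)). field. lra.
Qed.

(** No second derivative of [f] survives in the Einstein tensor, so one derivative of [m] is enough;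
    only [Phi] is differentiated twice, through [psi]. This covers [n = 1]. *)
Lemma type_I_source_diagonal (Phi m psi : R -> R) :
  horizon_free m ->
  (forall r, 0 < r -> ex_derive m r) ->
  (forall r, 0 < r -> is_derive Phi r (psi r)) ->
  (forall r, 0 < r -> ex_derive psi r) ->
  type_I_source Phi m.
Proof.
  intros Hh Dm DPhi Dpsi x a b Hx. destruct (Hx) as [Hr _].
  assert (DB : forall r, 0 < r -> is_derive (blackening m) r (Derive (blackening m) r)).
  { intros r Hr'. apply Derive_correct. eexists. apply is_derive_blackening; auto. }
  rewrite (frame_stress_energy_metric Phi m psi (blackening m) (Derive psi) (Derive (blackening m)));
    auto using Derive_correct.
  assert (E1 : Derive Phi (x Rad) = psi (x Rad)) by (apply is_derive_unique; auto).
  assert (E2 : Derive_n Phi 2 (x Rad) = Derive psi (x Rad)).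
  { apply (Derive_ext_loc (Derive Phi)). apply filter_imp with (2 := open_gt 0 (x Rad) Hr).
    intros s Hs. apply is_derive_unique; auto. }
  assert (E3 := is_derive_unique _ _ _ (is_derive_blackening m _ Hr (Dm _ Hr))).
  assert (P := PI_neq0).
  destruct a, b; simpl coord_eq_dec; cbv iota; try reflexivity; unfold einstein_frame_diag.
  - rewrite E3. unfold rho, blackening. field. lra.
  - unfold p_r. rewrite E1. unfold blackening. field. lra.
  - unfold p_perp. rewrite E1, E2. reflexivity.
  - unfold p_perp. rewrite E1, E2. reflexivity.
Qed.

(** * Potentials, asymptotics and junctions *)

Lemma constant_of_derive_0 (g : R -> R) (a b : R) : a <= b ->
  (forall r, a <= r <= b -> is_derive g r 0) -> g a = g b.
Proof.
  intros Hab D. destruct (Rle_lt_or_eq_dec a b Hab) as [H| ->]; [|reflexivity].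
  now apply eq_is_derive.
Qed.

Lemma is_lim_eventually_const (g : R -> R) (r0 c l : R) :
  (forall r, r0 <= r -> g r = c) -> is_lim g p_infty l -> c = l.
Proof.
  intros E Hl. assert (Hc : is_lim g p_infty c).
  { apply is_lim_ext_loc with (fun _ => c); [|apply is_lim_const].
    exists r0. intros r Hr. symmetry. apply E. lra. }
  apply is_lim_unique in Hl. apply is_lim_unique in Hc. congruence.
Qed.

Lemma filterlim_at_right_unique (g : R -> R) (a l1 l2 : R) :
  filterlim g (at_right a) (locally l1) -> filterlim g (at_right a) (locally l2) -> l1 = l2.
Proof. apply (filterlim_locally_unique (F := at_right a) g l1 l2). Qed.

Definition schwarzschild_Phi (M r : R) : R := / 2 * ln (1 - 2 * M / r).

Lemma schwarzschild_pos (M r : R) : 0 < r -> 2 * M < r -> 0 < 1 - 2 * M / r.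
Proof. intros Hr HM. enough (2 * M / r < 1) by lra. apply Rlt_div_l; lra. Qed.

Lemma is_derive_schwarzschild_Phi (M r : R) : 0 < r -> 2 * M < r ->
  is_derive (schwarzschild_Phi M) r (M / (r * (r - 2 * M))).
Proof.
  intros Hr HM. assert (P := schwarzschild_pos M r Hr HM). unfold schwarzschild_Phi.
  auto_derive. repeat split; lra. field. repeat split; lra.
Qed.

Lemma is_lim_schwarzschild_Phi (M : R) : is_lim (schwarzschild_Phi M) p_infty 0.
Proof.
  assert (H : is_lim (fun r => 1 - 2 * M * / r) p_infty (1 - 2 * M * 0)).
  { apply is_lim_minus'. apply is_lim_const.
    apply (is_lim_scal_l (fun r => / r) (2 * M) p_infty 0).
    apply (is_lim_inv (fun r => r) p_infty p_infty). apply is_lim_id. discriminate. }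
  replace (1 - 2 * M * 0) with 1 in H by ring.
  assert (C : continuous (fun u => / 2 * ln u) 1).
  { apply (ex_derive_continuous (fun u => / 2 * ln u)). auto_derive. lra. }
  assert (K := is_lim_comp_continuous _ _ _ _ H C). simpl in K.
  rewrite ln_1, Rmult_0_r in K. exact K.
Qed.

Lemma falls_off_ext (h g : R -> R) (r0 : R) : 0 < r0 ->
  (forall r, r0 < r -> h r = g r) -> falls_off g -> falls_off h.
Proof.
  intros H0 E Hg k Hk. destruct (Hg k Hk) as [C [R0 [HR0 B]]].
  exists C, (Rmax r0 R0). assert (M1 := Rmax_l r0 R0). assert (M2 := Rmax_r r0 R0).
  split. lra. intros r Hr.
  assert (L : locally r (fun s => g s = h s)).
  { apply filter_imp with (2 := open_gt r0 r ltac:(lra)). intros s Hs. symmetry. now apply E. }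
  destruct (B r) as [D1 D2]; [lra|]. split.
  - now apply ex_derive_n_ext_loc with g.
  - now rewrite <- (Derive_n_ext_loc g h k r L).
Qed.

(** For [r > 2 a] one has [1 / (r - a) <= 2 / r]. The exterior uses [a = 0] for [g_tt + 1] and
    [a = 2 M] for [g_rr - 1]. *)
Lemma falls_off_inv (c a : R) : 0 <= c -> 0 <= a -> falls_off (fun r => c / (r - a)).
Proof.
  intros Hc Ha.
  assert (D1 : forall r, a < r -> is_derive (fun s => c / (s - a)) r (- c / (r - a) ^ 2)).
  { intros r Hr. auto_derive. lra. field. lra. }
  assert (D2 : forall r, a < r -> is_derive (Derive (fun s => c / (s - a))) r (2 * c / (r - a) ^ 3)).
  { intros r Hr. apply is_derive_ext_loc with (fun s => - c / (s - a) ^ 2).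
    - apply filter_imp with (2 := open_gt a r Hr). intros s Hs. symmetry.
      now apply is_derive_unique, D1.
    - auto_derive. simpl. apply Rmult_integral_contrapositive; split; lra. field. lra. }
  assert (B : forall k r, 2 * a < r -> 0 < r -> / (r - a) ^ k <= 2 ^ k / r ^ k).
  { intros k r Hr Hr'. unfold Rdiv. rewrite <- pow_inv, <- (pow_inv r k), <- Rpow_mult_distr.
    apply pow_incr. split. left; apply Rinv_0_lt_compat; lra.
    apply (Rle_div_r _ 2 r); auto. rewrite Rmult_comm. apply (Rle_div_l r 2); lra. }
  (* The leading [2] bounds [k!] for [k <= 2], and [2 ^ (k + 1)] comes from [B]; the [+ 1] keeps the
     radius positive when [a = 0]. *)
  intros k Hk. exists (2 * c * 2 ^ (k + 1)), (2 * a + 1). split; [lra|]. intros r Hr.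
  assert (P : forall j, 0 <= / (r - a) ^ j).
  { intro j. left. apply Rinv_0_lt_compat, pow_lt. lra. }
  assert (Bc : 2 * c * / (r - a) ^ (k + 1) <= 2 * c * 2 ^ (k + 1) / r ^ (k + 1)).
  { replace (2 * c * 2 ^ (k + 1) / r ^ (k + 1)) with (2 * c * (2 ^ (k + 1) / r ^ (k + 1)))
      by (unfold Rdiv; ring).
    apply Rmult_le_compat_l; [lra|]. apply B; lra. }
  destruct k as [|[|[|k]]]; [| | |lia].
  - split. exact I. eapply Rle_trans; [|exact Bc]. specialize (P 1%nat). simpl in *.
    rewrite Rmult_1_r in *. rewrite Rabs_pos_eq; unfold Rdiv; nra.
  - split. eexists; apply D1; lra. eapply Rle_trans; [|exact Bc].
    replace (Derive_n (fun r => c / (r - a)) 1 r) with (- c / (r - a) ^ 2)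
      by (symmetry; apply is_derive_unique, D1; lra).
    specialize (P 2%nat). unfold Rdiv. rewrite Rabs_mult, Rabs_Ropp.
    rewrite !Rabs_pos_eq by (auto; lra). simpl Nat.add. nra.
  - split. eexists; apply D2; lra. eapply Rle_trans; [|exact Bc].
    replace (Derive_n (fun r => c / (r - a)) 2 r) with (2 * c / (r - a) ^ 3)
      by (symmetry; apply is_derive_unique, D2; lra).
    specialize (P 3%nat). unfold Rdiv. rewrite Rabs_mult.
    rewrite !Rabs_pos_eq by (auto; lra). simpl Nat.add. lra.
Qed.

Lemma no_jump_continuous (f : R -> R) (r0 : R) : continuous f r0 -> no_jump f r0.
Proof.
  intro C. exists (f r0). split; apply filterlim_filter_le_1 with (2 := C);
    apply filter_le_within.
Qed.

(** This [Phi'] is the one that makes the radial pressure vanish (an Einstein cluster). *)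
Lemma cluster_p_r (Phi m : R -> R) (r : R) : 0 < r -> 0 < r - 2 * m r ->
  is_derive Phi r (m r / (r * (r - 2 * m r))) -> p_r Phi m r = 0.
Proof.
  intros Hr Hm D. unfold p_r. rewrite (is_derive_unique _ _ _ D). unfold blackening.
  assert (P := PI_neq0). field. repeat split; auto; lra.
Qed.

(** Differentiating the equation for [Phi'] expresses [Phi''] by [m] and [m']; in the sum all terms
    free of [m'] cancel, which leaves a multiple of [rho]. *)
Lemma cluster_p_perp (Phi m : R -> R) (r : R) :
  0 < r -> 0 < r - 2 * m r -> ex_derive m r ->
  (forall s, 0 < s -> is_derive Phi s (m s / (s * (s - 2 * m s)))) ->
  p_perp Phi m r = rho m r * (m r / (2 * (r - 2 * m r))).
Proof.
  intros Hr Hm Dm D. unfold p_perp, rho.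
  rewrite (is_derive_unique _ _ _ (D r Hr)).
  rewrite (is_derive_unique _ _ _ (is_derive_blackening m r Hr Dm)).
  assert (E : Derive_n Phi 2 r = (Derive m r * (r * (r - 2 * m r))
     - m r * (2 * r - 2 * m r - 2 * r * Derive m r)) / (r * (r - 2 * m r)) ^ 2).
  { apply is_derive_unique. apply is_derive_ext_loc with (fun s => m s / (s * (s - 2 * m s))).
    - apply filter_imp with (2 := locally_pos r Hr). intros s Hs. symmetry.
      now apply is_derive_unique, D.
    - auto_derive. repeat split; auto. apply Rmult_integral_contrapositive; split; lra.
      rewrite (Derive_eta m _ _ (Derive_correct _ _ Dm)). field. lra. }
  rewrite E. unfold blackening. assert (P := PI_neq0). field. repeat split; auto; lra.
Qed.

(** The difference of two solutions is constant on [r > 0], and the limit at infinity makes it [0].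
    The centre follows from the limit from the right. *)
Lemma is_potential_unique (m Phi1 Phi2 : R -> R) :
  is_potential m Phi1 -> is_potential m Phi2 -> forall r, 0 <= r -> Phi1 r = Phi2 r.
Proof.
  intros [D1 [C1 L1]] [D2 [C2 L2]].
  pose (g := fun r => Phi1 r - Phi2 r).
  assert (Lg : is_lim g p_infty 0).
  { replace 0 with (0 - 0) by ring. now apply is_lim_minus'. }
  assert (Hg : forall r, 0 < r -> g r = 0).
  { intros r Hr. apply (is_lim_eventually_const g r); [|exact Lg].
    intros s Hs. symmetry. apply constant_of_derive_0; [lra|]. intros t Ht. evar_last.
    - apply @is_derive_minus; [apply D1 | apply D2]; lra.
    - apply Rminus_diag. }
  intros r [Hr|<-].
  - specialize (Hg r Hr). unfold g in Hg. lra.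
  - apply (filterlim_at_right_unique Phi1 0); [exact C1|].
    apply filterlim_ext_loc with Phi2; [|exact C2].
    exists (mkposreal 1 Rlt_0_1). intros s _ Hs. specialize (Hg s Hs). unfold g in Hg. lra.
Qed.

(** * The shell spacetime: potential, geometry and energy conditions *)

Section Shell.

Variables (n : nat) (eta L M : R).
Hypothesis Hn : (1 <= n)%nat.
Hypothesis He : 1 < eta.
Hypothesis HL : 0 < L.
Hypothesis HM : 0 < M.

Local Notation m := (mass n eta L M).

(** The form in which the bound on [M / L] enters this section. It yields [r - 2 * m r >= r / 5], so
    there is no horizon and the denominator of [rate] is positive for [r > 0]. *)
Hypothesis HDEC : forall r, 0 < r -> 5 * m r <= 2 * r.

Lemma areal_gap_pos (r : R) : 0 < r -> 0 < r - 2 * m r.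
Proof. intro Hr. assert (B := HDEC r Hr). lra. Qed.

Lemma ex_derive_mass (r : R) : ex_derive m r.
Proof. eexists. now apply is_derive_mass. Qed.

Lemma exterior_radius : 0 < eta * L /\ 2 * M < eta * L.
Proof.
  assert (0 < eta * L) by nra. split; auto.
  assert (B := areal_gap_pos (eta * L) H). rewrite mass_exterior in B by lra. lra.
Qed.

Lemma mass_horizon_free : horizon_free m.
Proof.
  intros r Hr. apply schwarzschild_pos; auto. assert (B := areal_gap_pos r Hr). lra.
Qed.

Definition rate (r : R) : R := m r / (r * (r - 2 * m r)).

Lemma rate_cavity (r : R) : r <= L -> rate r = 0.
Proof. intro Hr. unfold rate. rewrite mass_cavity by auto. unfold Rdiv. ring. Qed.

Lemma Cn_rate : Cn n rate.
Proof.
  assert (Cm := Cn_mass n eta L M Hn He HL).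
  apply Cn_mult; auto. apply Cn_inv.
  - intros r Hr. assert (B := areal_gap_pos r Hr). apply Rmult_integral_contrapositive. lra.
  - apply Cn_ext with (fun r => r * (r + -2 * m r)). intros; ring.
    auto using Cn_mult, Cn_plus, Cn_const, Cn_id.
Qed.

(** For [r <= L], negative radii included, the numerator vanishes, so the default value of the
    inverse does not matter. Continuity on the whole line makes the integral of [rate]
    differentiable at the centre too. *)
Lemma continuous_rate (r : R) : continuous rate r.
Proof.
  destruct (Rlt_dec r L) as [H|H].
  - apply continuous_ext_loc with (fun _ => 0); [|apply continuous_const].
    apply filter_imp with (2 := open_lt L r H). intros s Hs. symmetry. apply rate_cavity; lra.
  - apply (Cn_continuous _ _ _ Cn_rate). lra.
Qed.

Lemma ex_potential : exists Phi, is_potential m Phi.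
Proof.
  assert (X := exterior_radius).
  (* The constant matches the Schwarzschild potential at [eta * L]; beyond that radius the
     derivatives agree, so the limit at infinity is [0]. *)
  pose (Phi := fun r => schwarzschild_Phi M (eta * L) + RInt rate (eta * L) r).
  assert (D : forall r, is_derive Phi r (rate r)).
  { intro r. evar_last.
    - apply @is_derive_plus. apply is_derive_const.
      apply (is_derive_RInt rate (RInt rate (eta * L)) (eta * L)).
      + apply filter_forall. intro s. apply (RInt_correct rate).
        apply (ex_RInt_continuous rate). intros; apply continuous_rate.
      + apply continuous_rate.
    - apply Rplus_0_l. }
  exists Phi. split; [|split].
  - intros r _. apply D.
  - apply filterlim_filter_le_1 with (2 := ex_derive_continuous Phi 0 (ex_intro _ _ (D 0))).
    apply filter_le_within.
  - apply is_lim_ext_loc with (schwarzschild_Phi M); [|apply is_lim_schwarzschild_Phi].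
    exists (eta * L). intros r Hr.
    assert (E : schwarzschild_Phi M (eta * L) - Phi (eta * L) = schwarzschild_Phi M r - Phi r).
    { apply (constant_of_derive_0 (fun s => schwarzschild_Phi M s - Phi s)); [lra|].
      intros s Hs. evar_last.
      - apply @is_derive_minus; [apply is_derive_schwarzschild_Phi; lra | apply D].
      - unfold rate. rewrite mass_exterior by (auto; lra). apply Rminus_diag. }
    unfold Phi in E at 1. rewrite RInt_point in E. unfold zero in E; simpl in E. lra.
Qed.

Variable Phi : R -> R.
Hypothesis HPhi : is_potential m Phi.

Lemma potential_derive (r : R) : 0 < r -> is_derive Phi r (rate r).
Proof. apply HPhi. Qed.

Lemma Cn_potential : Cn (S n) Phi.
Proof. exists rate. split. apply potential_derive. apply Cn_rate. Qed.

(** Both functions satisfy the same equation beyond [eta * L] and tend to [0], so their constant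
    difference vanishes. *)
Lemma potential_exterior (r : R) : eta * L <= r -> Phi r = schwarzschild_Phi M r.
Proof.
  intro Hr. assert (X := exterior_radius).
  enough (schwarzschild_Phi M r - Phi r = 0) by lra.
  apply (is_lim_eventually_const (fun s => schwarzschild_Phi M s - Phi s) r).
  - intros s Hs. symmetry. apply (constant_of_derive_0 (fun s => schwarzschild_Phi M s - Phi s)); auto.
    intros t Ht. evar_last.
    + apply @is_derive_minus; [apply is_derive_schwarzschild_Phi; lra | apply potential_derive; lra].
    + unfold rate. rewrite mass_exterior by (auto; lra). apply Rminus_diag.
  - replace 0 with (0 - 0) by ring. apply is_lim_minus'. apply is_lim_schwarzschild_Phi. apply HPhi.
Qed.

Lemma exp_schwarzschild_Phi (r : R) : eta * L <= r ->
  exp (2 * schwarzschild_Phi M r) = 1 - 2 * M / r.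
Proof.
  intro Hr. assert (X := exterior_radius). unfold schwarzschild_Phi.
  rewrite <- Rmult_assoc, Rinv_r, Rmult_1_l by lra. apply exp_ln. apply schwarzschild_pos; lra.
Qed.

Lemma mass_schwarzschild_exterior : schwarzschild_exterior (eta * L) M Phi m.
Proof.
  intros r Hr. split; [|now apply mass_exterior].
  rewrite potential_exterior by auto. now apply exp_schwarzschild_Phi.
Qed.

Lemma mass_flat_cavity : flat_cavity L Phi m.
Proof.
  assert (E : forall r, 0 < r <= L -> Phi r = Phi L).
  { intros r Hr. apply constant_of_derive_0; [lra|]. intros s Hs.
    rewrite <- (rate_cavity s) by lra. apply potential_derive. lra. }
  exists (Phi L). intros r [[Hr|<-] Hr'].
  - split; auto using mass_cavity.
  - split; [now apply mass_cavity|].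
    (* The equation is not imposed at the centre; the value there is the limit of the constant
       values at small radii. *)
    apply (filterlim_at_right_unique Phi 0); [apply HPhi|].
    apply filterlim_ext_loc with (fun _ => Phi L); [|apply filterlim_const].
    exists (mkposreal L HL). intros s Hs Hs'. symmetry. apply E. split; auto.
    apply Rabs_def2 in Hs. unfold minus, plus, opp in Hs; simpl in Hs. lra.
Qed.

Lemma mass_asymptotically_flat : asymptotically_flat Phi m.
Proof.
  assert (X := exterior_radius). split.
  - apply falls_off_ext with (fun r => 2 * M / (r - 0)) (eta * L); [lra| |apply falls_off_inv; lra].
    intros r Hr. unfold g_tt. rewrite (proj1 (mass_schwarzschild_exterior r ltac:(lra))). field. lra.
  - apply falls_off_ext with (fun r => 2 * M / (r - 2 * M)) (eta * L); [lra| |apply falls_off_inv; lra].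
    intros r Hr. unfold g_rr, blackening. rewrite mass_exterior by (auto; lra). field. lra.
Qed.

Lemma Cn_blackening : Cn n (blackening m).
Proof.
  apply Cn_ext with (fun r => 1 + (-2 * m r) * / r).
  - intros r Hr. unfold blackening. field. lra.
  - apply Cn_plus; [apply Cn_const|]. apply Cn_mult.
    + apply Cn_mult; [apply Cn_const|]. now apply Cn_mass.
    + apply Cn_inv; [|apply Cn_id]. intros r Hr. lra.
Qed.

Lemma mass_Cn_spacetime : Cn_spacetime n Phi m.
Proof.
  split; intros k r Hk Hr; apply Cn_Derive_n with n; auto.
  - apply Cn_ext with (fun s => -1 * exp (2 * Phi s)). intros s _; unfold g_tt; ring.
    apply Cn_mult; [apply Cn_const|]. apply Cn_exp. apply Cn_mult; [apply Cn_const|].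
    apply Cn_S, Cn_potential.
  - apply Cn_inv; [|apply Cn_blackening]. intros s Hs. apply Rgt_not_eq, mass_horizon_free, Hs.
Qed.

(** The two fundamental forms contain [Phi], [Phi'] and an undifferentiated [f], all continuous at
    every positive radius, hence at both junctions. *)
Lemma mass_no_thin_shell (r : R) : 0 < r -> no_thin_shell_at Phi m r.
Proof.
  intros Hr theta a b _.
  assert (CP := Cn_continuous _ _ _ Cn_potential Hr).
  assert (CD : continuous (Derive Phi) r).
  { apply (Cn_Derive_n (S n) 1 Phi r); auto using Cn_potential with arith. }
  assert (CE : continuous (fun s => - exp (2 * Phi s)) r).
  { apply (continuous_opp (fun s => exp (2 * Phi s))). apply continuous_comp; [|apply continuous_exp].
    apply @continuous_mult; [apply continuous_const | exact CP]. }
  assert (CB : continuous (fun s => sqrt (blackening m s)) r).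
  { apply continuous_comp; [|apply continuous_sqrt]. exact (Cn_continuous _ _ _ Cn_blackening Hr). }
  assert (CR : continuous (fun s => s ^ 2) r) by apply continuous_pow, continuous_id.
  assert (CK : continuous (fun s => s * sqrt (blackening m s)) r).
  { apply @continuous_mult; [apply continuous_id | exact CB]. }
  split; apply no_jump_continuous; destruct a, b; unfold tube_h, tube_K;
    try apply continuous_const; auto.
  - apply @continuous_mult; [exact CR | apply continuous_const].
  - apply @continuous_mult; [|exact CD]. apply @continuous_mult; [exact CE | exact CB].
  - apply @continuous_mult; [apply continuous_const | exact CK].
Qed.

Lemma mass_type_I_source : type_I_source Phi m.
Proof.
  apply type_I_source_diagonal with rate; auto using mass_horizon_free, potential_derive.
  - intros r _. apply ex_derive_mass.
  (* [n >= 1] supplies the derivative of [rate], that is, [Phi'']. *)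
  - intros r Hr. assert (C := Cn_rate). destruct n as [|k]; [lia|].
    destruct C as [d [Hd _]]. exists (d r). auto.
Qed.

Lemma mass_p_r (r : R) : 0 < r -> p_r Phi m r = 0.
Proof. intro Hr. apply cluster_p_r; auto using areal_gap_pos. now apply potential_derive. Qed.

Lemma mass_p_perp (r : R) : 0 < r -> p_perp Phi m r = rho m r * (m r / (2 * (r - 2 * m r))).
Proof.
  intro Hr. apply cluster_p_perp; auto using areal_gap_pos, ex_derive_mass.
  intros s Hs. now apply potential_derive.
Qed.

Lemma rho_pos_iff (r : R) : 0 < r -> 0 < Derive m r <-> 0 < rho m r.
Proof.
  intro Hr. assert (P := PI_RGT_0). unfold rho.
  assert (0 < 4 * PI * r ^ 2) by (apply Rmult_lt_0_compat; nra).
  split; intro D.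
  - now apply Rdiv_lt_0_compat.
  - replace (Derive m r) with (Derive m r / (4 * PI * r ^ 2) * (4 * PI * r ^ 2)).
    now apply Rmult_lt_0_compat. field. split; lra.
Qed.

Lemma mass'_factor_pos : 0 < M / (L * (eta - 1)) / euler_beta (n + 1) (n + 1).
Proof.
  apply Rdiv_lt_0_compat; [|apply euler_beta_pos]. apply Rdiv_lt_0_compat; auto.
  apply Rmult_lt_0_compat; lra.
Qed.

Lemma rho_nonneg (r : R) : 0 < r -> 0 <= rho m r.
Proof.
  intro Hr. assert (P := PI_RGT_0). unfold rho.
  assert (0 < 4 * PI * r ^ 2) by (apply Rmult_lt_0_compat; nra).
  rewrite (is_derive_unique _ _ _ (is_derive_mass n eta L M r Hn He HL)).
  apply Rdiv_le_0_compat; auto. apply Rmult_le_pos; [|apply bump_nonneg].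
  left. apply mass'_factor_pos.
Qed.

Lemma mass_nontrivial : nontrivial m.
Proof.
  (* The middle of the shell, where [shell_coord] is [1 / 2]. *)
  exists (L * (1 + (eta - 1) / 2)).
  assert (H : 0 < L * (1 + (eta - 1) / 2)) by (apply Rmult_lt_0_compat; lra).
  split; auto. apply Rgt_not_eq. apply rho_pos_iff; auto.
  rewrite (is_derive_unique _ _ _ (is_derive_mass n eta L M _ Hn He HL)).
  apply Rmult_lt_0_compat. apply mass'_factor_pos. apply bump_pos.
  unfold shell_coord. replace ((_ / L - 1) / (eta - 1)) with (/ 2) by (field; lra). lra.
Qed.

Lemma pressure_ratio (r : R) : 0 < r -> 0 <= m r / (2 * (r - 2 * m r)) <= 1.
Proof.
  intro Hr. assert (B := HDEC r Hr). assert (P := mass_nonneg n eta L M r Hn He HL HM).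
  split. apply Rdiv_le_0_compat; lra. apply Rle_div_l; lra.
Qed.

Lemma mass_source_bounds (r : R) : 0 < r ->
  p_r Phi m r = 0 /\ 0 <= p_perp Phi m r <= rho m r.
Proof.
  intro Hr. split; [now apply mass_p_r|]. rewrite mass_p_perp by auto.
  assert (A := rho_nonneg r Hr). assert (B := pressure_ratio r Hr). split; nra.
Qed.

Lemma mass_DEC_saturated (r : R) : 0 < r -> 5 * m r = 2 * r -> 5 * Derive m r = 2 ->
  DEC_saturated Phi m.
Proof.
  intros Hr Em Ed. exists r. split; auto. split; [apply rho_pos_iff; auto; lra|].
  rewrite mass_p_perp by auto. replace (m r) with (2 * r / 5) by lra. field. lra.
Qed.

Lemma mass_strict_DEC : (forall r, 0 < r -> 5 * m r < 2 * r) -> strict_DEC_margin Phi m.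
Proof.
  intros HS r Hr Hrho. rewrite mass_p_r, Rabs_R0 by auto. split; auto.
  assert (B := HS r Hr). destruct (mass_source_bounds r Hr) as [_ [P _]].
  rewrite Rabs_pos_eq by auto. rewrite mass_p_perp by auto.
  assert (m r / (2 * (r - 2 * m r)) < 1) by (apply Rlt_div_l; lra). nra.
Qed.

End Shell.

(** Since [Phi] is given implicitly, the claim asks for existence, uniqueness and the properties of
    every solution. Uniqueness is stated for [r >= 0] because [is_potential] does not constrain
    negative radii. The clause on [is_max_on] certifies that the supremum [q] is a maximum. *)
Theorem theorem8 :
  (forall (n : nat) (eta : R), (1 <= n)%nat -> 1 < eta ->
     is_max_on (compactness n eta) 1 eta (q n eta)) /\
  (forall (n : nat) (eta L M : R),
     (1 <= n)%nat -> 1 < eta -> 0 < L -> 0 < M ->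
     0 < M / L <= mu_DEC n eta ->
     let m := mass n eta L M in
     (exists Phi : R -> R, is_potential m Phi) /\
     (forall Phi1 Phi2 : R -> R, is_potential m Phi1 -> is_potential m Phi2 ->
        forall r : R, 0 <= r -> Phi1 r = Phi2 r) /\
     (forall Phi : R -> R, is_potential m Phi ->
        nontrivial m /\
        asymptotically_flat Phi m /\
        horizon_free m /\
        Cn_spacetime n Phi m /\
        flat_cavity L Phi m /\
        schwarzschild_exterior (eta * L) M Phi m /\
        no_thin_shell_at Phi m L /\
        no_thin_shell_at Phi m (eta * L) /\
        type_I_source Phi m /\
        everywhere NEC Phi m /\
        everywhere WEC Phi m /\
        everywhere SEC Phi m /\
        everywhere DEC Phi m /\
        (M / L = mu_DEC n eta -> DEC_saturated Phi m) /\
        (M / L < mu_DEC n eta -> strict_DEC_margin Phi m))) /\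
  (0.380436713748 <= q 4 3 < 0.380436713749 /\
   1.051423234257 <= mu_DEC 4 3 < 1.051423234258).
Proof.
  split; [|split; [|exact q_4_3_digits]].
  { intros n eta _ He. now apply is_max_on_q. }
  intros n eta L M Hn He HL HM [_ Hmu] m.
  assert (HDEC : forall r, 0 < r -> 5 * mass n eta L M r <= 2 * r).
  { intros r Hr. now apply mass_DEC. }
  split; [now apply ex_potential|]. split; [apply is_potential_unique|].
  intros Phi HPhi.
  (* With [p_r = 0] and [0 <= p_perp <= rho], all four energy conditions are linear consequences. *)
  assert (S : forall r, 0 < r -> 0 <= rho m r /\ p_r Phi m r = 0 /\ 0 <= p_perp Phi m r <= rho m r).
  { intros r Hr. split. now apply rho_nonneg. now apply mass_source_bounds. }
  assert (HN : everywhere NEC Phi m).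
  { intros r Hr. specialize (S r Hr). split; lra. }
  split; [now apply mass_nontrivial|].
  split; [now apply mass_asymptotically_flat|].
  split; [now apply mass_horizon_free|].
  split; [now apply mass_Cn_spacetime|].
  split; [now apply mass_flat_cavity|].
  split; [now apply mass_schwarzschild_exterior|].
  split; [now apply mass_no_thin_shell|].
  split; [apply mass_no_thin_shell; auto; nra|].
  split; [now apply mass_type_I_source|].
  split; [exact HN|].
  split; [intros r Hr; split; [now apply S | now apply HN]|].
  split; [intros r Hr; split; [now apply HN | specialize (S r Hr); lra]|].
  split; [intros r Hr; specialize (S r Hr); split; apply Rabs_le; lra|].
  split; intro Hlt.
  - destruct (mass_saturated n eta L M Hn He HL HM Hlt) as [r [Hr [Em Ed]]].
    now apply mass_DEC_saturated with r.
  - apply mass_strict_DEC; auto. intros r Hr. now apply mass_DEC_strict.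
Qed.
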